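(* Let $(\rho,m)$ be a smooth solution on $[0,T]$ of the compressible network flow problem (F1)--(F6) defined in the context. Then for all $0<t\le T$, all $q\in L^2(\mathcal E)$ and all $v\in H_0(\mathrm{div})$ (the test functions $q,v$ being independent of time), one has \begin{align*} (\partial_t\rho,q)_{\mathcal E} &= -(\partial_x' m,q)_{\mathcal E},\\ \Big(\tfrac1\rho\partial_t m-\tfrac{m}{2\rho^2}\partial_t\rho,\,v\Big)_{\mathcal E} &=\Big(\tfrac{m^2}{2\rho^2}+P'(\rho)-\tfrac{a}{\rho^2}\partial_x' m,\ \partial_x' v\Big)_{\mathcal E}-\Big(\tfrac{m}{2\rho^2}\partial_x' m+b\tfrac{|m|m}{\rho^2},\,v\Big)_{\mathcal E}, \end{align*} where $\rho=\rho(t)$ and $m=m(t)$.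
   Context: Network. $\mathcal G=(\mathcal V,\mathcal E,\ell)$ is a finite, directed, connected graph with vertex set $\mathcal V$, edge set $\mathcal E\subset\mathcal V\times\mathcal V$, and lengths $\ell_e>0$, $e\in\mathcal E$. An edge $e=(v_1,v_2)$ is identified with the interval $[0,\ell_e]$ ($v_1$ corresponding to $0$, $v_2$ to $\ell_e$), and $n_e(v_1)=-1$, $n_e(v_2)=1$. $\mathcal E(v)$ is the set of edges incident on $v$; $\mathcal V_0=\{v:|\mathcal E(v)|\ge2\}$ are the inner vertices, $\mathcal V_\partial=\mathcal V\setminus\mathcal V_0$ the boundary vertices. Function spaces. For a function $u$ on the network, $u_e=u|_e$. $L^2(\mathcal E)$, $L^\infty(\mathcal E)$, $H^s(\mathcal E)$ are the spaces of functions with $u_e\in L^2(e)$, $L^\infty(e)$, $H^s(e)$, respectively, for every $e$ (no continuity at vertices). $(u,v)_{\mathcal E}=\sum_{e\in\mathcal E}\int_0^{\ell_e}u_ev_e\,dx$ and $\int_{\mathcal E}u\,dx=\sum_e\int_0^{\ell_e}u_e\,dx$. The broken derivative $\partial_x'u$ is $(\partial_x'u)|_e=\partial_x(u_e)$. $u_e(v)$ is the value of $u_e$ at the endpoint $v$. $H_0(\mathrm{div})=\{m\in H^1(\mathcal E):\sum_{e\in\mathcal E(v)}m_e(v)n_e(v)=0\ \forall v\in\mathcal V\}$. $H^1_+(\mathcal E)=\{\rho\in H^1(\mathcal E):\exists\,\underline\rho>0,\ \rho\ge\underline\rho\text{ a.e. on }\mathcal E\}$. Data. $a_e,b_e\ge0$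 and $c_e>0$ are constants on each edge and $a,b$ denote the edgewise constant functions with values $a_e,b_e$; $\gamma>1$; $p_e(\rho)=c_e\rho^\gamma$, $P_e(\rho)=\frac{c_e}{\gamma-1}\rho^\gamma$; $P(\rho),P'(\rho)$ denote the functions with restrictions $P_e(\rho_e),P_e'(\rho_e)$ to $e$. Flow problem: (F1) $\partial_t\rho_e+\partial_xm_e=0$ for all $e\in\mathcal E$; (F2) $\partial_tm_e+\partial_x\big(\frac{m_e^2}{\rho_e}+p_e(\rho_e)\big)=a_e\rho_e\,\partial_x\big(\frac1{\rho_e^2}\partial_xm_e\big)-b_e\frac{|m_e|m_e}{\rho_e}$ for all $e\in\mathcal E$; (F3) $p_e(\rho)=c_e\rho^\gamma$ and $P_e(\rho)=\frac{c_e}{\gamma-1}\rho^\gamma$ for all $e\in\mathcal E$; (F4) $\sum_{e\in\mathcal E(v)}m_e(v)n_e(v)=0$ for all $v\in\mathcal V_0$; (F5) for every $v\in\mathcal V_0$ there is a value $h_v$ (depending on time but not on $e$) with $\frac{m_e(v)^2}{2\rho_e(v)^2}+P_e'(\rho_e(v))=h_v+\frac{a_e}{\rho_e(v)^2}\partial_xm_e(v)$ for all $e\in\mathcal E(v)$; (F6) $m_e(v)n_e(v)=0$ for all $v\in\mathcal V_\partial$, $e\in\mathcal E(v)$. A smooth solution on $[0,T]$ is a pair $(\rho,m)\in C^1([0,T];L^\infty(\mathcal E)\times L^2(\mathcal E))\cap C([0,T];H^1_+(\mathcal E)\times H^2(\mathcal E))$ satisfying these equations for all $t>0$ (i.e.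 $0<t\le T$) and a.e. on $\mathcal E$. *)

(* Defs.v *)
From mathcomp Require Import all_boot all_order all_algebra.
From mathcomp Require Import all_classical all_reals all_analysis.

Set Implicit Arguments.
Unset Strict Implicit.
Unset Printing Implicit Defensive.

Import Order.TTheory GRing.Theory Num.Theory.
Import numFieldNormedType.Exports.

Local Open Scope classical_set_scope.
Local Open Scope ring_scope.

Local Notation mu := lebesgue_measure.

(* An L^p or Sobolev function on an interval (0,l) is represented by any
   function R -> R, whose values outside `[0,l] are irrelevant.  All the notions
   below only depend, measurability aside, on the class of the function modulo
   a.e. equality. *)
Section Interval.
Variables (R : realType) (l : R).
Implicit Types (u f g phi : R -> R) (k : nat) (p : \bar R).

Definition Lp_norm p u : \bar R := Lnorm mu p (EFin \o (u \_ `[0, l])).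

Definition Lp p : set (R -> R) :=
  [set u | u \_ `[0, l] \in Lfun mu p].

(* C^1_c(0,l), the test functions of Brezis's definition of W^{1,p}(0,l); they
   give the same weak derivatives as C^infty_c(0,l). *)
Definition test_function phi : Prop :=
  [/\ forall x, derivable phi x 1,
      continuous (derive1 phi)
    & exists a b, [/\ 0 < a, b < l
        & forall x, x \notin `[a, b] -> phi x = 0]].

Definition weak_derivative u g : Prop :=
  [/\ mu.-integrable `[0, l] (EFin \o u),
      mu.-integrable `[0, l] (EFin \o g)
    & forall phi, test_function phi ->
        \int[mu]_(x in `[0, l]) (u x * derive1 phi x) =
        - \int[mu]_(x in `[0, l]) (g x * phi x)].

(* A representative of the weak derivative; weak derivatives are unique up to
   a.e. equality. *)
Definition dx u : R -> R := xget (fun=> 0) [set g | weak_derivative u g].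

Fixpoint Hs k : set (R -> R) :=
  if k is k'.+1 then
    [set u | Lp 2%:E u /\ exists g, weak_derivative u g /\ Hs k' g]
  else Lp 2%:E.

Definition Hs_norm k u : \bar R :=
  (\sum_(i < k.+1) Lp_norm 2%:E (iter i dx u))%E.

(* The value at x in `[0,l] of the continuous representative of u. *)
Definition trace u (x : R) : R :=
  xget 0 [set y | exists f, [/\ {within `[0, l], continuous f},
    {ae mu, forall z, z \in `[0, l] -> u z = f z} & y = f x]].

End Interval.

(* The condition e.1 != e.2 is what makes the sign n_e(v) and the value u_e(v)
   well defined. *)
Record network (R : realType) := Network {
  vertex : finType;
  edges : {set vertex * vertex};
  len : vertex * vertex -> R;
  len_gt0 : forall e, e \in edges -> 0 < len e;
  edges_irrefl : forall e, e \in edges -> e.1 != e.2;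
  edges_connected : forall v w : vertex,
    connect (fun x y => ((x, y) \in edges) || ((y, x) \in edges)) v w
}.

Section Network.
Variables (R : realType) (G : network R).

Definition edge : Type := (vertex G * vertex G)%type.

(* Only the components u e with e \in edges G are relevant. *)
Definition netfun : Type := edge -> R -> R.

Implicit Types (u : netfun) (e : edge) (v : vertex G).

Definition incident v : {set edge} :=
  [set e : edge in edges G | (e.1 == v) || (e.2 == v)]%SET.

Definition inner v : bool := (1 < #|incident v|)%N.
Definition boundary v : bool := ~~ inner v.

Definition normal e v : R :=
  if v == e.1 then -1 else if v == e.2 then 1 else 0.

Definition endpoint e v : R := if v == e.1 then 0 else len e.

Definition at_vertex u e v : R := trace (len e) (u e) (endpoint e v).

Definition ip u u' : R :=
  \sum_(e in edges G) \int[mu]_(x in `[0, len e]) (u e x * u' e x).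

Definition ae_net (P : edge -> R -> Prop) : Prop :=
  forall e, e \in edges G -> {ae mu, forall x, x \in `[0, len e] -> P e x}.

Definition Dx u : netfun := fun e => dx (len e) (u e).

Definition LpE (p : \bar R) : set netfun :=
  [set u | forall e, e \in edges G -> Lp (len e) p (u e)].

Definition HsE (k : nat) : set netfun :=
  [set u | forall e, e \in edges G -> Hs (len e) k (u e)].

(* As there are finitely many edges, summing the norms of the components gives
   a norm equivalent to the usual one. *)
Definition LpE_norm (p : \bar R) u : \bar R :=
  (\sum_(e in edges G) Lp_norm (len e) p (u e))%E.

Definition HsE_norm (k : nat) u : \bar R :=
  (\sum_(e in edges G) Hs_norm (len e) k (u e))%E.

Definition H1plus : set netfun :=
  [set u | HsE 1 u /\
    exists2 r : R, 0 < r & ae_net (fun e x => r <= u e x)].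

Definition H0div : set netfun :=
  [set u | HsE 1 u /\
    forall v, \sum_(e in incident v) at_vertex u e v * normal e v = 0].

(* C([0,T]; X), where X is a set of network functions normed by N. *)
Definition C0 (X : set netfun) (N : netfun -> \bar R) (T : R)
    (w : R -> netfun) : Prop :=
  (forall t, t \in `[0, T] -> X (w t)) /\
  (forall t, t \in `[0, T] ->
     N (fun e x => w s e x - w t e x) @[s --> within `[0, T] (nbhs t)]
       --> 0%E).

(* w is in C^1([0,T]; X) with time derivative w', one-sided at t = 0 and t = T. *)
Definition C1 (X : set netfun) (N : netfun -> \bar R) (T : R)
    (w w' : R -> netfun) : Prop :=
  [/\ forall t, t \in `[0, T] -> X (w t),
      C0 X N T w'
    & forall t, t \in `[0, T] ->
        N (fun e x => (w s e x - w t e x) / (s - t) - w' t e x)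
          @[s --> within (`[0, T] `\ t) (nbhs t)] --> 0%E].

Definition pressure (c : edge -> R) (gamma : R) e (r : R) : R :=
  c e * r `^ gamma.

Definition potential (c : edge -> R) (gamma : R) e (r : R) : R :=
  c e / (gamma - 1) * r `^ gamma.

(* The equations at a fixed time, for the values rho, m, dtrho, dtm at that time
   of density, mass flux and their time derivatives. *)
Record flow_equations (a b c : edge -> R) (gamma : R)
    (rho m dtrho dtm : netfun) : Prop := FlowEquations {
  flow_mass : ae_net (fun e x => dtrho e x + Dx m e x = 0);
  flow_momentum : ae_net (fun e x =>
    dtm e x
    + Dx (fun e y => m e y ^+ 2 / rho e y + pressure c gamma e (rho e y)) e x
    = a e * rho e x * Dx (fun e y => (rho e y ^+ 2)^-1 * Dx m e y) e x
      - b e * (`|m e x| * m e x / rho e x));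
  flow_inner_mass : forall v, inner v ->
    \sum_(e in incident v) at_vertex m e v * normal e v = 0;
  flow_inner_enthalpy : forall v, inner v -> exists h : R,
    forall e, e \in incident v ->
      at_vertex m e v ^+ 2 / (2 * at_vertex rho e v ^+ 2)
      + derive1 (potential c gamma e) (at_vertex rho e v)
      = h + a e / at_vertex rho e v ^+ 2 * at_vertex (Dx m) e v;
  flow_boundary : forall v, boundary v -> forall e, e \in incident v ->
    at_vertex m e v * normal e v = 0
}.

(* dtrho and dtm are the time derivatives of rho and m. *)
Record smooth_solution (a b c : edge -> R) (gamma T : R)
    (rho m dtrho dtm : R -> netfun) : Prop := SmoothSolution {
  rho_C1 : C1 (LpE +oo%E) (LpE_norm +oo%E) T rho dtrho;
  m_C1 : C1 (LpE 2%:E) (LpE_norm 2%:E) T m dtm;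
  rho_C0 : C0 H1plus (HsE_norm 1) T rho;
  m_C0 : C0 (HsE 2) (HsE_norm 2) T m;
  sol_eqs : forall t, 0 < t <= T ->
    flow_equations a b c gamma (rho t) (m t) (dtrho t) (dtm t)
}.

End Network.

(* Main.v *)
(* Dividing (F2) by rho and using (F1) gives, a.e. on every edge,
     (1/rho) dt m - m/(2 rho^2) dt rho
       = - dx H - m/(2 rho^2) dx m - b |m|m/rho^2,
   where H = m^2/(2 rho^2) + P'(rho) - (a/rho^2) dx m lies in W^{1,1}. Testing
   with v and integrating dx H by parts on each edge leaves the boundary terms
   sum_x sum_(e in E(x)) H_e(x) v_e(x) n_e(x). They vanish at each vertex x:
   H_e(x) does not depend on the edge e incident on x (this is (F5) at inner
   vertices, and trivial at boundary vertices, which have at most one edge),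
   and the fluxes v_e(x) n_e(x) sum to zero.

   The calculus of weak derivatives needed here is obtained through indefinite
   Lebesgue integrals F x = F 0 + int_0^x f. For these, the chain rule follows
   from the mean value theorem and uniform continuity, and the du Bois-Reymond
   lemma shows that every weakly differentiable function is of this form a.e. *)
Require Import Defs.
From mathcomp Require Import all_boot all_order all_algebra.
From mathcomp Require Import all_classical all_reals all_analysis.
From mathcomp Require Import measurable_realfun ring lra.

Set Implicit Arguments.
Unset Strict Implicit.
Unset Printing Implicit Defensive.

Import Order.TTheory GRing.Theory Num.Theory.
Import numFieldNormedType.Exports.

Local Open Scope classical_set_scope.
Local Open Scope ring_scope.

Local Notation mu := lebesgue_measure.

#[local] Instance ae_lebesgue_filter (R : realType) :
  Filter (nbhs (almost_everywhere (@lebesgue_measure R))).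
Proof. exact: (ae_filter_ringOfSetsType mu). Qed.

(** * Integrals under almost everywhere comparison, free of measurability conditions *)

Section ae_integral.
Context d (T : measurableType d) (R : realType).
Variable m : {measure set T -> \bar R}.
Import HBNNSimple.

(* A simple function below [f], cut off on the exceptional null set, is below
   [g]. *)
Lemma ge0_ae_le_integral (D : set T) (f g : T -> \bar R) :
  (forall x, D x -> (0 <= f x)%E) -> (forall x, D x -> (0 <= g x)%E) ->
  {ae m, forall x, D x -> (f x <= g x)%E} ->
  (\int[m]_(x in D) f x <= \int[m]_(x in D) g x)%E.
Proof.
move=> f0 g0 [N [mN N0 fgN]].
have mCN := measurableC mN.
rewrite integral_mkcond [leRHS]integral_mkcond !ge0_integralTE; last 2 first.
- by move=> x; rewrite erestrict_ge0.
- by move=> x; rewrite erestrict_ge0.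
apply: ge_ereal_sup => _ [h hf <-].
have -> : sintegral m h = sintegral m (proj_nnsfun h mCN).
  rewrite -[in LHS](patch_setT (fun=> 0) h)
    -[in RHS](patch_setT (fun=> 0) (proj_nnsfun h mCN)).
  rewrite -!integral_nnsfun//; apply: ge0_ae_eq_integral => //.
  - exact/measurable_EFinP.
  - exact/measurable_EFinP.
  - by move=> x _; rewrite lee_fin.
  - by move=> x _; rewrite lee_fin.
  exists N; split=> // x /=; apply: contra_notP => xN _.
  by rewrite mindicE mem_set// mulr1.
apply: ereal_sup_ubound; exists (proj_nnsfun h mCN) => //= x.
rewrite mindicE; have [xN|xN] := boolP (x \in ~` N); last first.
  by rewrite mulr0 erestrict_ge0.
rewrite mulr1 (le_trans (hf x))// /patch; case: ifPn => // /set_mem Dx.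
move: xN => /set_mem; apply: contra_notP => nfg.
by apply: fgN => /=; apply/not_implyP.
Qed.

(** Positive and negative parts are compared in both directions by [ge0_ae_le_integral]. As neither
    measurability nor integrability is required, an integrand of [ip] can be replaced by any a.e.
    equal one. *)
Lemma Rintegral_ae_eq (D : set T) (f g : T -> R) :
  {ae m, forall x, D x -> f x = g x} ->
  \int[m]_(x in D) f x = \int[m]_(x in D) g x.
Proof.
move=> fg; congr fine; rewrite integralE [RHS]integralE.
congr (_ - _)%E; apply/eqP; rewrite eq_le; apply/andP; split;
  apply: ge0_ae_le_integral => //; apply: filterS fg => x /[apply] fgx;
  by rewrite ?funepos.unlock ?funeneg.unlock /= fgx.
Qed.

(* When a part of [f] has infinite integral both sides are the junk value
   [fine (+oo) = fine (-oo) = 0]. *)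
Lemma RintegralN (D : set T) (f : T -> R) :
  \int[m]_(x in D) (- f x) = - \int[m]_(x in D) f x.
Proof.
rewrite /Rintegral integralE [in RHS]integralE.
rewrite (_ : (fun x => (- f x)%:E) = (\- (EFin \o f))%E)//.
rewrite funeposN funenegN.
have : (0 <= \int[m]_(x in D) (EFin \o f)^\+ x)%E by exact: integral_ge0.
have : (0 <= \int[m]_(x in D) (EFin \o f)^\- x)%E by exact: integral_ge0.
rewrite -/(EFin \o f).
by case: (\int[m]_(x in D) (EFin \o f)^\+ x)%E => [a| |]//;
   case: (\int[m]_(x in D) (EFin \o f)^\- x)%E => [b| |]//= _ _;
   rewrite ?oppr0// opprB.
Qed.

End ae_integral.

(** * Indefinite Lebesgue integrals and uniform continuity on a segment *)

Section primitive.
Variable R : realType.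
Implicit Types (l x y s t : R) (f g F G phi : R -> R).

(** Encodes absolute continuity of [F] on [[0, l]] with a.e. derivative [f], that is, the continuous
    representative of a W^{1,1} function. *)
Definition primitive l F f : Prop :=
  mu.-integrable `[0, l] (EFin \o f) /\
  forall x, x \in `[0, l] -> F x = F 0 + \int[mu]_(t in `[0, x]) f t.

Lemma integrable_subitv l s t f : 0 <= s -> t <= l ->
  mu.-integrable `[0, l] (EFin \o f) -> mu.-integrable `[s, t] (EFin \o f).
Proof.
move=> s0 tl; apply: integrableS => //.
by apply: subset_itv; rewrite bnd_simp.
Qed.

Lemma primitive_increment l F f s t : primitive l F f ->
  0 <= s -> s <= t -> t <= l -> F t - F s = \int[mu]_(x in `[s, t]) f x.
Proof.
move=> [fi Ff] s0 st tl.
rewrite Ff ?in_itv/= ?(le_trans s0 st)//.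
rewrite (Ff s) ?in_itv/= ?s0 ?(le_trans st tl)//.
rewrite opprD addrACA subrr add0r (@Rintegral_itvB _ f (BLeft 0) (BRight t) s) ?bnd_simp//.
  rewrite Rintegral_itv_obnd_cbnd//.
  apply: integrableS (integrable_subitv s0 tl fi) => //.
  by apply: subset_itvr; rewrite bnd_simp.
exact: integrable_subitv tl fi.
Qed.

Lemma within_continuousP (A : set R) f : {within A, continuous f} <->
  forall x, A x -> f y @[y --> within A (nbhs x)] --> f x.
Proof. exact: subspace_continuousP. Qed.

Lemma primitive_continuous l F f : 0 <= l ->
  primitive l F f -> {within `[0, l], continuous F}.
Proof.
move=> l0 [fi Ff].
have /within_continuousP cI := parameterized_integral_continuous l0 fi.
apply/within_continuousP => x xl; rewrite (Ff _ xl).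
apply: cvg_trans (cvgD (cvg_cst (F 0)) (cI x xl)).
apply: near_eq_cvg; rewrite near_withinE; apply: nearW => y /= yl.
by rewrite (Ff y).
Qed.

(** Cutting [[0, x]] into equal pieces shorter than [d] and telescoping bounds the increment of [F]
    by [e * (G x - G 0)] for every positive [e]. In the chain rule, [G] is the integral of the
    absolute value of the derivative. *)
Lemma const_of_small_increments l F G :
  (forall e, 0 < e -> exists2 d, 0 < d &
    forall s t, 0 <= s -> s <= t -> t <= l -> t - s < d ->
      `|F t - F s| <= e * (G t - G s)) ->
  forall x, x \in `[0, l] -> F x = F 0.
Proof.
move=> H x /[!in_itv]/= /andP[x0 xl].
have Hx e : 0 < e -> `|F x - F 0| <= e * (G x - G 0).
  move=> e0; have [d d0 Hd] := H e e0.
  have [n nd] : exists n : nat, x / n.+1%:R < d.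
    exists (Num.truncn (x / d)); rewrite ltr_pdivrMr// mulrC -ltr_pdivrMr//.
    exact: Num.Theory.truncnS_gt.
  pose p (i : nat) := x * (i%:R / n.+1%:R).
  have pn : p n.+1 = x by rewrite /p divff ?mulr1.
  have p0 : p 0%N = 0 by rewrite /p mul0r mulr0.
  have : forall i, (i <= n.+1)%N -> `|F (p i) - F 0| <= e * (G (p i) - G 0).
    elim=> [_|i ih ltin]; first by rewrite p0 !subrr normr0 mulr0.
    have -> : F (p i.+1) - F 0 = (F (p i.+1) - F (p i)) + (F (p i) - F 0).
      by rewrite addrA subrK.
    rewrite (le_trans (ler_normD _ _))//.
    have -> : e * (G (p i.+1) - G 0) =
              e * (G (p i.+1) - G (p i)) + e * (G (p i) - G 0) by ring.
    apply: lerD; last exact/ih/ltnW.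
    apply: Hd.
    - by rewrite /p mulr_ge0// divr_ge0.
    - by rewrite /p ler_wpM2l// ler_wpM2r// ?invr_ge0// ler_nat.
    - rewrite (le_trans _ xl)// /p ler_piMr// ler_pdivrMr// mul1r ler_nat//.
    - have -> : p i.+1 - p i = x / n.+1%:R; last by [].
      by rewrite /p -mulrBr -mulrBl -natrB// subSnn mul1r.
  by move=> /(_ n.+1 (leqnn _)); rewrite pn.
apply/eqP; rewrite -subr_eq0 -normr_le0; apply/ler_addgt0Pr => e e0.
rewrite add0r.
(* The bound is used with [e] divided by this quantity; adding 1 keeps the divisor nonzero when
   [G x = G 0]. *)
have K0 : 0 < `|G x - G 0| + 1 by rewrite ltr_wpDl.
apply: le_trans (Hx _ (divr_gt0 e0 K0)) _.
rewrite mulrAC ler_pdivrMr// ler_wpM2l// ?(ltW e0)//.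
by rewrite (le_trans (ler_norm _))// lerDl.
Qed.

Lemma within_continuous_uniform l f : {within `[0, l], continuous f} ->
  forall e, 0 < e -> exists2 d, 0 < d & forall x y,
    x \in `[0, l] -> y \in `[0, l] -> `|x - y| < d -> `|f x - f y| < e.
Proof.
move=> /within_continuousP cf e e0.
(* Heine's theorem: the modulus [d] runs along the filter [0^'+], and compactness turns a modulus
   valid near each point into one valid on the whole segment. *)
have /compact_near_coveringP/near_covering_withinP := @segment_compact R 0 l.
move=> /(_ R 0^'+ (fun d x => forall y, y \in `[0, l] -> `|x - y| < d ->
  `|f x - f y| < e)) [].
  move=> x xl.
  have e20 : 0 < e / 2 by rewrite divr_gt0.
  have /cvgrPdist_lt/(_ _ e20) := cf _ xl.
  rewrite near_withinE => /nbhs_ballP[d /= d0 Hd].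
  have d20 : 0 < d / 2 by rewrite divr_gt0.
  exists (ball x (d / 2), [set r | r < d / 2]).
    split; first exact: nbhsx_ballx.
    exact: nbhs_right_lt.
  move=> [y r] /= [xy rd] yl z zl yz.
  have -> : f y - f z = (f x - f z) - (f x - f y) by ring.
  rewrite (le_lt_trans (ler_normB _ _))// (splitr e) ltrD//.
    apply: Hd => //; rewrite /ball/=.
    have -> : x - z = (x - y) + (y - z) by ring.
    rewrite (le_lt_trans (ler_normD _ _))// (splitr d) ltrD//.
    exact: lt_trans rd.
  by apply: Hd => //; apply: le_ball xy; rewrite ler_pdivrMr// mulr2n mulrDr mulr1 lerDl ltW.
move=> d /= d0 Hd; exists (d / 2); first by rewrite divr_gt0.
move=> x y xl yl xy; apply: (Hd (d / 2)) => //=; last by rewrite divr_gt0.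
by rewrite sub0r normrN gtr0_norm ?divr_gt0// ltr_pdivrMr// ltr_pMr// ltr1n.
Qed.

End primitive.

(** * Chain rule, product rule and integration by parts for indefinite integrals *)

Section primitive_calculus.
Variable R : realType.
Implicit Types (l x y s t k : R) (f g F G phi dphi : R -> R).

Lemma primitive_integral l f : mu.-integrable `[0, l] (EFin \o f) ->
  primitive l (fun x => \int[mu]_(t in `[0, x]) f t) f.
Proof. by move=> fi; split=> // x _; rewrite set_itv1 Rintegral_set1 add0r. Qed.

Lemma integrable_mul_continuous l f g : {within `[0, l], continuous g} ->
  mu.-integrable `[0, l] (EFin \o f) ->
  mu.-integrable `[0, l] (EFin \o (fun x => g x * f x)).
Proof.
move=> cg fi.
have -> : EFin \o (fun x => g x * f x) = ((EFin \o g) \* (EFin \o f))%E.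
  by apply/funext => x.
apply: integrableMr => //.
  by apply: subspace_continuous_measurable_fun.
have /compact_bounded[M [_ mrt]] := continuous_compact cg (@segment_compact _ 0 l).
by exists M; split; rewrite ?num_real// => ? ? ? ?; exact: mrt.
Qed.

Lemma integrable_continuous_mul l f g : {within `[0, l], continuous g} ->
  mu.-integrable `[0, l] (EFin \o f) ->
  mu.-integrable `[0, l] (EFin \o (fun x => f x * g x)).
Proof.
move=> cg fi; rewrite (_ : (fun x => _) = (fun x => g x * f x)).
  exact: integrable_mul_continuous.
by apply/funext => x; rewrite mulrC.
Qed.

(** By the intermediate value theorem [F] takes every value between [F s] and [F t]. Hence [phi] is
    differentiable on that whole range, and the intermediate point given by the mean value theorem
    is itself some [F y]. *)
Lemma mean_value_comp F phi dphi s t : s <= t ->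
  {within `[s, t], continuous F} ->
  (forall x, x \in `[s, t] -> is_derive (F x) 1 phi (dphi (F x))) ->
  exists2 y, y \in `[s, t] & phi (F t) - phi (F s) = dphi (F y) * (F t - F s).
Proof.
move=> st cF dF.
have dv v : Num.min (F s) (F t) <= v <= Num.max (F s) (F t) -> is_derive v 1 phi (dphi v).
  by move=> /(IVT st cF)[c cst <-]; exact: dF.
have [Fst|Fts] := leP (F s) (F t).
- have dst v : v \in `[F s, F t] -> is_derive v 1 phi (dphi v).
    by rewrite in_itv/= => v_; apply: dv; rewrite min_l ?max_r.
  have [|z zFst ->] := MVT_segment Fst (fun v vst => dst v (subset_itv_oo_cc vst)).
    by apply: derivable_within_continuous => v /dst[].
  have [|c cst <-] := IVT st cF (v := z).
    by move: zFst; rewrite in_itv/= min_l ?max_r.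
  by exists c.
- have {}Fts := ltW Fts.
  have dst v : v \in `[F t, F s] -> is_derive v 1 phi (dphi v).
    by rewrite in_itv/= => v_; apply: dv; rewrite min_r ?max_l.
  have [|z zFst H] := MVT_segment Fts (fun v vst => dst v (subset_itv_oo_cc vst)).
    by apply: derivable_within_continuous => v /dst[].
  have [|c cst cz] := IVT st cF (v := z).
    by move: zFst; rewrite in_itv/= min_r ?max_l.
  by exists c => //; rewrite cz -opprB H -mulrN opprB.
Qed.

(** On a short segment the defect [D] changes by the integral of [(dphi (F y) - dphi (F x)) * f x]
    with [y] fixed. Uniform continuity of [dphi \o F] bounds it by [e] times the integral of the
    absolute value of [f], so [D] is constant. *)
Lemma primitive_comp l F f phi dphi : primitive l F f ->
  (forall x, x \in `[0, l] -> is_derive (F x) 1 phi (dphi (F x))) ->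
  {within `[0, l], continuous (dphi \o F)} ->
  primitive l (phi \o F) (fun x => dphi (F x) * f x).
Proof.
move=> Ff dF cd; have [fi _] := Ff.
have gi := integrable_mul_continuous cd fi.
split=> // x xl; have l0 : 0 <= l.
  by move: xl; rewrite in_itv/= => /andP[]; exact: le_trans.
have cF := primitive_continuous l0 Ff.
set g := (fun x => _ * _) in gi *.
pose D y := phi (F y) - \int[mu]_(t in `[0, y]) g t.
have absfi : mu.-integrable `[0, l] (EFin \o (Num.norm \o f)) by exact: integrable_norm.
suff /(_ x xl) : forall x, x \in `[0, l] -> D x = D 0.
  by rewrite /D set_itv1 Rintegral_set1 subr0 /= => <-; rewrite subrK.
apply: (@const_of_small_increments _ l D (fun y => \int[mu]_(t in `[0, y]) `|f t|)) => e e0.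
have [d d0 Hd] := within_continuous_uniform cd e0.
exists d => // s t s0 st tl tsd.
have fst : mu.-integrable `[s, t] (EFin \o f) by exact: integrable_subitv fi.
have gst : mu.-integrable `[s, t] (EFin \o g) by exact: integrable_subitv gi.
have afst : mu.-integrable `[s, t] (EFin \o (Num.norm \o f)) by exact: integrable_subitv absfi.
have sub : `[s, t] `<=` `[0, l] by apply: subset_itv; rewrite bnd_simp.
rewrite (primitive_increment (primitive_integral absfi) s0 st tl).
have -> : D t - D s = (phi (F t) - phi (F s)) - \int[mu]_(x in `[s, t]) g x.
  by rewrite -(primitive_increment (primitive_integral gi) s0 st tl) /D; ring.
have cFst : {within `[s, t], continuous F} := continuous_subspaceW sub cF.
have dFst z : z \in `[s, t] -> is_derive (F z) 1 phi (dphi (F z)).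
  by move=> /sub; exact: dF.
have [y yst yE] := mean_value_comp st cFst dFst.
have yfi : mu.-integrable `[s, t] (EFin \o (fun x => dphi (F y) * f x)).
  exact: (integrableZl _ _ fst).
have dfi : mu.-integrable `[s, t] (EFin \o (fun x => dphi (F y) * f x - g x)).
  exact: (integrableB _ yfi gst).
rewrite yE (primitive_increment Ff s0 st tl) -RintegralZl// -RintegralB//.
apply: le_trans (le_normr_Rintegral _ dfi) _ => //.
rewrite -RintegralZl//; apply: le_Rintegral => //.
- exact: integrable_norm dfi.
- exact: (integrableZl _ _ afst).
move=> z zst; rewrite /g -mulrBl normrM ler_wpM2r// ltW//.
apply: Hd; [exact: sub|exact: sub|].
move: yst zst; rewrite /= !in_itv/= => /andP[sy yt] /andP[sz zt].
by rewrite (le_lt_trans _ tsd)// ler_norml; apply/andP; split; lra.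
Qed.

Lemma primitive_cst l k : primitive l (fun=> k) (fun=> 0).
Proof.
split; first by rewrite (_ : _ \o _ = cst 0%E)//; exact: integrable0.
by move=> x _; rewrite Rintegral_cst// mul0r addr0.
Qed.

Lemma primitiveD l F f G g : primitive l F f -> primitive l G g ->
  primitive l (fun x => F x + G x) (fun x => f x + g x).
Proof.
move=> [fi Ff] [gi Gg]; split; first exact: (integrableD _ fi gi).
move=> x xl; rewrite (Ff x)// (Gg x)// RintegralD//; first ring.
- by apply: (integrable_subitv (lexx 0) _ fi); move: xl; rewrite in_itv/= => /andP[].
- by apply: (integrable_subitv (lexx 0) _ gi); move: xl; rewrite in_itv/= => /andP[].
Qed.

Lemma primitiveZ l k F f : primitive l F f ->
  primitive l (fun x => k * F x) (fun x => k * f x).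
Proof.
move=> [fi Ff]; split; first exact: (integrableZl _ k fi).
move=> x xl; rewrite (Ff x)// RintegralZl//; first ring.
by apply: (integrable_subitv (lexx 0) _ fi); move: xl; rewrite in_itv/= => /andP[].
Qed.

Lemma eq_primitive l F f G g : F =1 G -> f =1 g ->
  primitive l F f -> primitive l G g.
Proof. by move=> /funext <- /funext <-. Qed.

Lemma primitive_sqr l F f : 0 <= l -> primitive l F f ->
  primitive l (fun x => F x ^+ 2) (fun x => 2 * F x * f x).
Proof.
move=> l0 Ff.
apply: (@primitive_comp l F f (fun y => y ^+ 2) (fun y => 2 * y) Ff).
  by move=> x _; apply: is_derive_eq; rewrite /= /GRing.scale/=; ring.
exact: (primitive_continuous l0 (primitiveZ 2 Ff)).
Qed.

(* Polarization of [primitive_sqr]. *)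
Lemma primitiveM l F f G g : 0 <= l -> primitive l F f -> primitive l G g ->
  primitive l (fun x => F x * G x) (fun x => f x * G x + F x * g x).
Proof.
move=> l0 Ff Gg.
have /(primitiveZ (2^-1)) := primitiveD (primitive_sqr l0 (primitiveD Ff Gg))
  (primitiveZ (-1) (primitiveD (primitive_sqr l0 Ff) (primitive_sqr l0 Gg))).
by apply: eq_primitive => x; field.
Qed.

Lemma integration_by_parts_primitive l F f G g : 0 <= l ->
  primitive l F f -> primitive l G g ->
  \int[mu]_(x in `[0, l]) (F x * g x) =
  F l * G l - F 0 * G 0 - \int[mu]_(x in `[0, l]) (f x * G x).
Proof.
move=> l0 Ff Gg; have [fi _] := Ff; have [gi _] := Gg.
have [_ /(_ l)] := primitiveM l0 Ff Gg.
rewrite in_itv/= l0 lexx => /(_ isT) ->.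
rewrite RintegralD//; first ring.
  exact: integrable_continuous_mul (primitive_continuous l0 Gg) fi.
exact: integrable_mul_continuous (primitive_continuous l0 Ff) gi.
Qed.

End primitive_calculus.

(** * The du Bois-Reymond lemma *)

Section fundamental_lemma.
Variable R : realType.
Implicit Types (l x y : R) (n : nat) (f g h w psi phi : R -> R).

Lemma integrable_patchT a b f : mu.-integrable `[a, b] (EFin \o f) ->
  mu.-integrable setT (EFin \o f \_ `[a, b]).
Proof.
move=> fi; rewrite -restrict_EFin.
have [H _]:= @integrable_mkcond _ _ R mu `[a, b] (EFin \o f) (measurable_itv _).
exact: H.
Qed.

Lemma Rintegral_cst_itv x k : 0 <= x -> \int[mu]_(y in `[0, x]) k = k * x.
Proof.
move=> x0; rewrite Rintegral_cst//; congr (_ * _).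
transitivity (fine (if 0%:E < x%:E then x%:E - 0%:E else 0)%E).
  by congr fine; exact: (lebesgue_measure_itv `[0, x]).
move: x0; rewrite lte_fin le_eqVlt => /predU1P[<-|->]; first by rewrite ltxx.
by rewrite /= subr0.
Qed.

(** By Lebesgue differentiation [h] is a.e. the derivative of its indefinite integral, which is
    identically zero on the segment. *)
Lemma ae_eq0_of_integral0 l h : mu.-integrable `[0, l] (EFin \o h) ->
  (forall x, x \in `[0, l] -> \int[mu]_(t in `[0, x]) h t = 0) ->
  {ae mu, forall x, x \in `[0, l] -> h x = 0}.
Proof.
move=> hi h0.
pose hl := h \_ `[0, l].
have hli : mu.-integrable setT (EFin \o hl) by exact: integrable_patchT.
have li y : mu.-integrable [set` Interval (BLeft 0) (BRight y)] (EFin \o hl).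
  exact: integrableS hli.
have Fae := FTC1 li (integrable_locally (measurable_itv _) hi).
(* The endpoints are discarded as null sets, because the indefinite integral is only known to vanish
   on a neighbourhood of interior points. *)
have ne k : {ae mu, forall x, x != k}.
  exists [set k]; split => //; first exact: lebesgue_measure_set1.
  by move=> x /= /negP/negPn/eqP.
apply: filterS3 (ne 0) (ne l) Fae => x x0 xl + xin.
have {x0 xl xin} /andP[x0 xl] : 0 < x < l.
  by move: xin; rewrite in_itv/= lt_def x0 lt_neqAle xl.
case; first by rewrite (@lte_fin R).
move=> _.
rewrite /hl patchE mem_set/= ?in_itv/= ?(ltW x0) ?(ltW xl)// => <-.
rewrite derive1E.
rewrite (@near_eq_derive _ _ _ _ (cst 0)) ?derive_cst//.
near=> y.
have [y0 yl] : 0 < y /\ y < l by split; near: y; [exact: lt_nbhsr|exact: lt_nbhsl].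
rewrite -[RHS](h0 y) ?in_itv/= ?(ltW y0) ?(ltW yl)//.
apply: eq_Rintegral => z; rewrite inE/= in_itv/= => /andP[z0 zy].
by rewrite patchE mem_set//= in_itv/= z0 (le_trans zy (ltW yl)).
Unshelve. all: by end_near. Qed.

(** The antiderivative from minus infinity vanishes left of [a] by the support of [psi], and right
    of [b] because [psi] has zero mean. *)
Lemma test_function_integral l psi a b : 0 < a -> b < l ->
  continuous psi -> (forall y, y \notin `[a, b] -> psi y = 0) ->
  \int[mu]_(y in `[0, l]) psi y = 0 ->
  exists2 phi, test_function l phi & derive1 phi = psi.
Proof.
move=> a0 bl cpsi psi0 ipsi.
have psiE : psi = psi \_ `[a, b].
  apply/funext => y; rewrite patchE; case: ifPn => // yab.
  by apply: psi0; move: yab; rewrite notin_setE/= => /negP.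
have psii : mu.-integrable setT (EFin \o psi).
  rewrite psiE; apply: integrable_patchT.
  by apply: continuous_compact_integrable; [exact: segment_compact|exact: continuous_subspaceT].
pose phi y := \int[mu]_(t in `]-oo, y]) psi t.
have dphi y : derivable phi y 1 /\ derive1 phi y = psi y.
  apply: (@continuous_FTC1 _ _ _ _ (y + 1)); rewrite ?ltrDl//.
  - exact: integrableS psii.
  - exact: ltNyr.
  - exact: cpsi.
exists phi; last by apply/funext => y; have [] := dphi y.
split; first by move=> y; have [] := dphi y.
  by rewrite (_ : derive1 phi = psi)//; apply/funext => y; have [] := dphi y.
exists a, b; split => // y yab.
have [ya|ay] := ltP y a.
  rewrite /phi (_ : \int[mu]_(t in _) _ = \int[mu]_(t in `]-oo, y]) 0).
    by rewrite Rintegral_cst// mul0r.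
  apply: eq_Rintegral => z; rewrite inE/= in_itv/= => zy; apply: psi0.
  by rewrite in_itv/= leNgt (le_lt_trans zy ya).
have yb : b < y by move: yab; rewrite in_itv/= ay/= -ltNge.
rewrite -ipsi /phi Rintegral_mkcond [RHS]Rintegral_mkcond.
congr Rintegral; apply/funext => z; rewrite !patchE.
have [zab|zab] := boolP (z \in `[a, b]); last by rewrite psi0// !if_same.
move: zab; rewrite in_itv/= => /andP[az zb].
rewrite !mem_set//= in_itv/= ?(le_trans zb (ltW yb))//.
by rewrite (le_trans (ltW a0) az) (le_trans zb (ltW bl)).
Qed.

(** A trapezoid: 0 where [y] or [x - y] is at most 1/(n+1), and 1 where both are at least 2/(n+1).
    It tends pointwise to the indicator of []0, x[] while its support stays away from 0 and [x]. *)
Definition cutoff n x y : R :=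
  Num.min 1 (Num.max 0 (n.+1%:R * Num.min y (x - y) - 1)).

Lemma cutoff_continuous n x : continuous (cutoff n x).
Proof.
have cmin : continuous (fun y => Num.min y (x - y)).
  apply: (@min_fun_continuous _ _ _ id (fun y => x - y)); first by move=> y; exact: cvg_id.
  by move=> y; apply: cvgB; [exact: cvg_cst|exact: cvg_id].
rewrite /cutoff; apply: (@min_fun_continuous _ R R (fun=> 1)
  (fun y => Num.max 0 (n.+1%:R * Num.min y (x - y) - 1))).
  by move=> y; exact: cvg_cst.
apply: (@max_fun_continuous _ R R (fun=> 0)
  (fun y => n.+1%:R * Num.min y (x - y) - 1)).
  by move=> y; exact: cvg_cst.
move=> y; apply: cvgB; last exact: cvg_cst.
by apply: cvgM; [exact: cvg_cst|exact: cmin].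
Qed.

Lemma cutoff_ge0 n x y : 0 <= cutoff n x y.
Proof. by rewrite /cutoff le_min ler01 le_max lexx. Qed.

Lemma cutoff_le1 n x y : cutoff n x y <= 1.
Proof. by rewrite /cutoff ge_min lexx. Qed.

Lemma cutoff_eq0 n x y : y \notin `[n.+1%:R^-1, x - n.+1%:R^-1] ->
  cutoff n x y = 0.
Proof.
move=> yout; rewrite /cutoff (@max_l _ _ 0) ?(@min_r _ _ 1)//.
rewrite subr_le0 mulrC -ler_pdivlMr// div1r ge_min.
move: yout; rewrite in_itv/= negb_and -!ltNge => /orP[/ltW ->//|].
by move=> /ltW xy; rewrite lerBlDr -lerBlDl xy orbT.
Qed.

Lemma cutoff_cvg l x w : x \in `[0, l] -> mu.-integrable `[0, l] (EFin \o w) ->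
  \int[mu]_(y in `[0, l]) (w y * cutoff n x y) @[n --> \oo] -->
  \int[mu]_(y in `[0, x]) w y.
Proof.
rewrite in_itv/= => /andP[x0 xl] wi.
have wxi : mu.-integrable `[0, x] (EFin \o w) by exact: integrable_subitv wi.
(* The pointwise limit of the cutoffs is the indicator of the open interval, so the endpoints are
   dropped before dominated convergence. *)
have -> : \int[mu]_(y in `[0, x]) w y = \int[mu]_(y in `[0, l]) (w \_ `]0, x[) y.
  rewrite -Rintegral_mkcondr setIidr; last first.
    by apply: subset_itv; rewrite bnd_simp.
  rewrite -Rintegral_itv_obnd_cbnd; last first.
    by apply: integrableS wxi => //; apply: subset_itvr; rewrite bnd_simp.
  rewrite -Rintegral_itv_bndo_bndc//.
  by apply: integrableS wxi => //; apply: subset_itv; rewrite bnd_simp.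
apply: fine_cvg; rewrite fineK; last first.
  apply: integrable_fin_num => //.
  rewrite (_ : (fun y => _) = (EFin \o w) \_ `]0, x[); last by rewrite restrict_EFin.
  apply/integrable_restrict => //; rewrite setIidr; last first.
    by apply: subset_itv; rewrite bnd_simp.
  by apply: integrableS wi => //; apply: subset_itv; rewrite bnd_simp.
apply: (@dominated_cvg _ _ _ mu `[0, l] (measurable_itv _)
  (fun n y => (w y * cutoff n x y)%:E) (EFin \o w \_ `]0, x[)
  (EFin \o (Num.norm \o w))) => //.
- move=> n; apply/measurable_EFinP/measurable_funM.
    by apply/measurable_EFinP; exact: measurable_int wi.
  by apply: measurable_funTS; exact: continuous_measurable_fun (@cutoff_continuous n x).
- move=> y _; apply: cvg_EFin; first exact: nearW.
  rewrite patchE; case: ifPn => [|yx].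
    rewrite inE/= in_itv/= => /andP[y0 yx].
    have m0 : 0 < Num.min y (x - y) by rewrite lt_min y0 subr_gt0.
    apply: cvg_near_cst; near=> n.
    rewrite /= /cutoff min_l ?mulr1// le_max; apply/orP; right.
    rewrite lerBrDr -ler_pdivrMr//.
    (* From this [n] on, [y] lies on the plateau of the trapezoid, so the sequence is eventually
       constant. *)
    have : 2 / Num.min y (x - y) <= n%:R.
      by near: n; exact: nbhs_infty_ger.
    by move=> /le_trans; apply; rewrite ler_nat.
  apply: cvg_near_cst; apply: nearW => n; rewrite /= cutoff_eq0 ?mulr0//.
  apply: contraNN yx; rewrite inE/= !in_itv/= => /andP[ny yn].
  have n0 : 0 < n.+1%:R^-1 :> R by rewrite invr_gt0.
  rewrite (lt_le_trans n0 ny) -subr_gt0 (lt_le_trans n0)//.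
  by rewrite lerBrDr -lerBrDl.
- exact: integrable_norm.
- move=> n y _; rewrite /= lee_fin normrM ler_piMr//.
  by rewrite ger0_norm ?cutoff_ge0// cutoff_le1.
Unshelve. all: by end_near. Qed.

(* Pairing [w] with an antiderivative of a zero-mean combination of the cutoffs
   of [0, x] and [0, l], then letting them tend to indicator functions, shows
   that [x |-> \int_0^x w] is linear. *)
Lemma du_bois_reymond l w : 0 < l -> mu.-integrable `[0, l] (EFin \o w) ->
  (forall phi, test_function l phi ->
    \int[mu]_(x in `[0, l]) (w x * derive1 phi x) = 0) ->
  exists k, {ae mu, forall x, x \in `[0, l] -> w x = k}.
Proof.
move=> l0 wi wphi.
have ci k : mu.-integrable `[0, l] (EFin \o cst k).
  by apply: continuous_compact_integrable; [exact: segment_compact|move=> ?; exact: cvg_cst].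
have lin x : x \in `[0, l] -> (\int[mu]_(t in `[0, x]) w t) * l =
    (\int[mu]_(t in `[0, l]) w t) * x.
  move=> xl.
  have ll : l \in `[0, l] by rewrite in_itv/= ltW// lexx.
  (* The sequences in [H1] and [H2] converge to the two sides of the claim; it remains to see that
     they agree term by term. *)
  have /(_ _) H1 := cvgM (cutoff_cvg xl wi) (cutoff_cvg ll (ci 1)).
  have /(_ _) H2 := cvgM (cutoff_cvg ll wi) (cutoff_cvg xl (ci 1)).
  have mux : \int[mu]_(y in `[0, x]) (cst 1) y = x.
    by rewrite Rintegral_cst_itv ?mul1r//; move: xl; rewrite in_itv/= => /andP[].
  have mul : \int[mu]_(y in `[0, l]) (cst 1) y = l.
    by rewrite Rintegral_cst_itv ?mul1r// ltW.
  rewrite mul in H1; rewrite mux in H2.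
  rewrite -(cvg_lim (@Rhausdorff R) H1); apply: cvg_lim; first exact: Rhausdorff.
  apply: cvg_trans H2.
  apply: near_eq_cvg; apply: nearW => n /=.
  have cint y : mu.-integrable `[0, l] (EFin \o cutoff n y).
    apply: continuous_compact_integrable; first exact: segment_compact.
    by apply: continuous_subspaceT; exact: cutoff_continuous.
  have wcint y : mu.-integrable `[0, l] (EFin \o (fun z => w z * cutoff n y z)).
    exact: integrable_continuous_mul (continuous_subspaceT (@cutoff_continuous n y)) wi.
  under [X in _ * X]eq_Rintegral do rewrite mul1r.
  under [X in _ = _ * X]eq_Rintegral do rewrite mul1r.
  set Jx := \int[mu]_(_ in _) cutoff n x _; set Jl := \int[mu]_(_ in _) cutoff n l _.
  have n0 : 0 < n.+1%:R^-1 :> R by rewrite invr_gt0.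
  have xlel : x <= l by move: xl; rewrite in_itv/= => /andP[].
  (* The weights [Jl] and [Jx] are the integrals of the opposite cutoffs, which makes the mean zero;
     since [x <= l], the support of the cutoff for [l] contains both supports. *)
  have [||||phi tphi dphi] := @test_function_integral l
    (fun y => Jl * cutoff n x y - Jx * cutoff n l y) n.+1%:R^-1 (l - n.+1%:R^-1) n0.
  - by rewrite ltrBlDr ltrDl.
  - move=> y; apply: cvgB; apply: cvgM; (try exact: cvg_cst); exact: cutoff_continuous.
  - move=> y yout; rewrite !cutoff_eq0 ?mulr0 ?subr0//.
    apply: contra yout; rewrite !in_itv/= => /andP[-> /le_trans]; apply.
    by rewrite lerD2r.
  - rewrite RintegralB//; [|exact: (integrableZl _ _ (cint _))|exact: (integrableZl _ _ (cint _))].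
    by rewrite !RintegralZl// -/Jx -/Jl mulrC subrr.
  have := wphi _ tphi; rewrite dphi.
  set Ix := \int[mu]_(_ in _) (w _ * cutoff n x _).
  set Il := \int[mu]_(_ in _) (w _ * cutoff n l _).
  rewrite (_ : \int[mu]_(y in _) _ = Jl * Ix - Jx * Il).
    by move=> /eqP; rewrite subr_eq0 mulrC => /eqP ->; rewrite mulrC.
  rewrite -!RintegralZl// -RintegralB//; last 2 first.
  - exact: (integrableZl _ _ (wcint _)).
  - exact: (integrableZl _ _ (wcint _)).
  by apply: eq_Rintegral => y _; ring.
(* The constant is the mean of [w]; by [lin], all integrals of [w - k] over [[0, x]] vanish. *)
pose k := (\int[mu]_(t in `[0, l]) w t) / l; exists k.
have : {ae mu, forall x, x \in `[0, l] -> w x - k = 0}.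
  apply: ae_eq0_of_integral0; first exact: (integrableB _ wi (ci k)).
  move=> x xl; have /andP[x0 xlel] : 0 <= x <= l by move: xl; rewrite in_itv.
  rewrite RintegralB//; last 2 first.
  - exact: integrable_subitv wi.
  - exact: (integrable_subitv (lexx 0) xlel (ci k)).
  rewrite Rintegral_cst_itv// (_ : \int[mu]_(t in `[0, x]) w t = k * x) ?subrr//.
  by rewrite /k mulrAC -lin// mulfK// gt_eqF.
by apply: filterS => x /[apply] /eqP; rewrite subr_eq0 => /eqP.
Qed.

End fundamental_lemma.

(** * Weak derivatives and traces in terms of indefinite integrals *)

Section weak_derivative.
Variable R : realType.
Implicit Types (l x y : R) (f g u F G phi : R -> R).

Lemma test_function_primitive l phi : 0 < l -> test_function l phi ->
  [/\ primitive l phi (derive1 phi), phi 0 = 0 & phi l = 0].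
Proof.
move=> l0 [dphi cphi [a [b [a0 bl phi0]]]]; split.
- split.
    apply: continuous_compact_integrable; first exact: segment_compact.
    exact: continuous_subspaceT.
  move=> x; rewrite in_itv/= => /andP[]; rewrite le_eqVlt => /predU1P[<-|x0] _.
    by rewrite set_itv1 Rintegral_set1 addr0.
  have cont y : {for y, continuous phi} by apply: differentiable_continuous; exact/derivable1_diffP.
  have -> : \int[mu]_(t in `[0, x]) derive1 phi t = phi x - phi 0; last by rewrite addrC subrK.
  have phiLR : derivable_oo_LRcontinuous phi 0 x.
    split => //.
    - by apply: cvg_at_right_filter; exact: cont.
    - by apply: cvg_at_left_filter; exact: cont.
  have c' := continuous_subspaceT cphi.
  by have /(congr1 (@fine R)) := continuous_FTC2 x0 (c' _) phiLR (fun=> fun=> erefl).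
- by apply: phi0; rewrite in_itv/= negb_and -!ltNge a0.
- by apply: phi0; rewrite in_itv/= negb_and -!ltNge bl orbT.
Qed.

(** Measurability of [u] is a separate hypothesis because it is not inherited through a.e.
    equality. *)
Lemma ae_integrable l u F : measurable_fun `[0, l] u ->
  mu.-integrable `[0, l] (EFin \o F) ->
  {ae mu, forall x, x \in `[0, l] -> u x = F x} ->
  mu.-integrable `[0, l] (EFin \o u).
Proof.
move=> mu_ Fi uF; apply/integrableP; split; first exact/measurable_EFinP.
have /integrableP[_] := Fi; apply: le_lt_trans.
by apply: ge0_ae_le_integral => //; apply: filterS uF => x /[apply] /= ->.
Qed.

Lemma primitive_weak_derivative l u F f : 0 < l -> primitive l F f ->
  measurable_fun `[0, l] u ->
  {ae mu, forall x, x \in `[0, l] -> u x = F x} ->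
  weak_derivative l u f.
Proof.
move=> l0 Ff mu_ uF; have cF := primitive_continuous (ltW l0) Ff.
split; [|by case: Ff|move=> phi tphi].
  apply: ae_integrable uF => //.
  by apply: continuous_compact_integrable => //; exact: segment_compact.
have [pphi phi0 phil] := test_function_primitive l0 tphi.
have := integration_by_parts_primitive (ltW l0) Ff pphi.
rewrite phi0 phil !mulr0 subrr sub0r => <-.
by apply: Rintegral_ae_eq; apply: filterS uF => x /[apply] ->.
Qed.

(** If [G] is the indefinite integral of [g], then [u - G] has zero weak derivative and is a.e. a
    constant by [du_bois_reymond]; that constant is added to [G]. *)
Lemma weak_derivative_primitive l u g : 0 < l -> weak_derivative l u g ->
  exists2 F, primitive l F g & {ae mu, forall x, x \in `[0, l] -> u x = F x}.
Proof.
move=> l0 [ui gi ug]; pose G x := \int[mu]_(t in `[0, x]) g t.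
have Gg : primitive l G g := primitive_integral gi.
have cG := primitive_continuous (ltW l0) Gg.
have Gi : mu.-integrable `[0, l] (EFin \o G).
  by apply: continuous_compact_integrable => //; exact: segment_compact.
have wi : mu.-integrable `[0, l] (EFin \o (fun x => u x - G x)).
  exact: (integrableB _ ui Gi).
have [phi tphi|k wk] := du_bois_reymond l0 wi.
  have [pphi phi0 phil] := test_function_primitive l0 tphi.
  have [_ cphi _] := tphi.
  have c' := continuous_subspaceT cphi.
  rewrite (_ : (fun x => _) = (fun x => u x * derive1 phi x - G x * derive1 phi x)); last first.
    by apply/funext => x; rewrite mulrBl.
  rewrite RintegralB//; last 2 first.
  - exact: integrable_continuous_mul (c' _) ui.
  - exact: integrable_continuous_mul (c' _) Gi.
  rewrite ug// (integration_by_parts_primitive (ltW l0) Gg pphi).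
  by rewrite phi0 phil !mulr0 subrr sub0r subrr.
exists (fun x => G x + k).
  by apply: eq_primitive (primitiveD Gg (primitive_cst l k)) => // x; rewrite addr0.
by apply: filterS wk => x /[apply] <-; rewrite addrC subrK.
Qed.

(** Near [x], endpoints included, [[0, l]] contains a nondegenerate segment, whose positive measure
    forbids it to lie in a null set. *)
Lemma ae_near_itv l x e (P : R -> Prop) : x \in `[0, l] -> 0 < l -> 0 < e ->
  {ae mu, forall y, y \in `[0, l] -> P y} ->
  exists y, [/\ y \in `[0, l], `|x - y| < e & P y].
Proof.
rewrite in_itv/= => /andP[x0 xl] l0 e0 [N [mN N0 PN]]; apply: contrapT => nP.
(* The radius [e / 2] keeps the closed segment inside the open ball of radius [e]. *)
pose s := Num.max 0 (x - e / 2); pose t := Num.min l (x + e / 2).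
have st : s < t.
  by rewrite /s /t lt_min !gt_max l0 /=; apply/andP; split; [|apply/andP; split]; lra.
have stN : `[s, t]%classic `<=` N.
  move=> y; rewrite /= in_itv/= /s /t ge_max le_min => /andP[/andP[y0 xy] /andP[yl yx]].
  apply: PN => /= yP; apply: nP; exists y; split; first by rewrite in_itv/= y0.
    by rewrite ltr_norml; apply/andP; split; lra.
  by apply: yP; rewrite in_itv/= y0.
have st0 : mu `[s, t]%classic = 0%E by exact: subset_measure0 mN stN N0.
suff : mu `[s, t]%classic = (t - s)%:E.
  by rewrite st0 => -[] /esym/eqP; rewrite subr_eq0 gt_eqF.
transitivity (if s%:E < t%:E then t%:E - s%:E else 0)%E.
  exact: (lebesgue_measure_itv `[s, t]).
by rewrite lte_fin st.
Qed.

Lemma continuous_ae_eq l F G : 0 < l ->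
  {within `[0, l], continuous F} -> {within `[0, l], continuous G} ->
  {ae mu, forall x, x \in `[0, l] -> F x = G x} ->
  forall x, x \in `[0, l] -> F x = G x.
Proof.
move=> l0 cF cG FG x xl; apply/eqP; rewrite -subr_eq0 -normr_le0.
apply/ler_addgt0Pr => e e0; rewrite add0r.
have [d d0 Hd] := within_continuous_uniform (within_continuousB cF cG) e0.
have [y [yl yx Py]] := ae_near_itv xl l0 d0 FG.
by have := Hd _ _ xl yl yx; rewrite /= !fctE Py subrr subr0 => /ltW.
Qed.

Lemma primitive_unique l F f G g : 0 < l -> primitive l F f -> primitive l G g ->
  {ae mu, forall x, x \in `[0, l] -> F x = G x} ->
  {ae mu, forall x, x \in `[0, l] -> f x = g x}.
Proof.
move=> l0 Ff Gg FG.
have E := continuous_ae_eq l0 (primitive_continuous (ltW l0) Ff)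
  (primitive_continuous (ltW l0) Gg) FG.
have [fi _] := Ff; have [gi _] := Gg.
have : {ae mu, forall x, x \in `[0, l] -> f x - g x = 0}.
  apply: ae_eq0_of_integral0; first exact: (integrableB _ fi gi).
  move=> x xl; have /andP[x0 xlel] : 0 <= x <= l by move: xl; rewrite in_itv.
  rewrite RintegralB//; last 2 first.
  - exact: integrable_subitv fi.
  - exact: integrable_subitv gi.
  rewrite -(primitive_increment Ff)// -(primitive_increment Gg)//.
  by rewrite !E ?subrr// in_itv/= lexx ltW.
by apply: filterS => x /[apply] /eqP; rewrite subr_eq0 => /eqP.
Qed.

Lemma weak_derivative_dx l u g : weak_derivative l u g ->
  weak_derivative l u (dx l u).
Proof.
move=> ug; rewrite /dx.
exact: (@xgetPex _ (fun=> 0) [set g | weak_derivative l u g] (ex_intro _ g ug)).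
Qed.

(** This is how [dx] gets computed: it is an arbitrarily chosen weak derivative, and
    [primitive_unique] identifies any two of them a.e. *)
Lemma dx_ae_eq l u F f : 0 < l -> primitive l F f ->
  measurable_fun `[0, l] u ->
  {ae mu, forall x, x \in `[0, l] -> u x = F x} ->
  {ae mu, forall x, x \in `[0, l] -> dx l u x = f x}.
Proof.
move=> l0 Ff mu_ uF.
have := weak_derivative_dx (primitive_weak_derivative l0 Ff mu_ uF).
move=> /(weak_derivative_primitive l0)[G Gdx uG].
apply: (primitive_unique l0 Gdx Ff).
by apply: filterS2 uF uG => x uF uG xl; rewrite -uF// -uG.
Qed.

(** Two continuous representatives agree at every point of [[0, l]], so the choice made by [xget]
    does not matter, and the existence of [F] rules out the default value 0. *)
Lemma trace_ae_eq l u F : 0 < l -> {within `[0, l], continuous F} ->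
  {ae mu, forall x, x \in `[0, l] -> u x = F x} ->
  forall x, x \in `[0, l] -> trace l u x = F x.
Proof.
move=> l0 cF uF x xl; rewrite /trace.
case: xgetP => [y _ [f [cf uf ->]]|/(_ (F x))]; last first.
  by case; exists F.
apply: (continuous_ae_eq l0) => //.
by apply: filterS2 uF uf => z uF uf zl; rewrite -uF// -uf.
Qed.

(** Peels off one derivative. The function [g] is kept apart from [dx l u]: [Hs] provides regularity
    of some weak derivative, to which the chosen one is only a.e. equal. *)
Lemma Hs_primitive l k u : 0 < l -> Hs l k.+1 u ->
  [/\ measurable_fun `[0, l] u,
      exists2 F, primitive l F (dx l u) &
        {ae mu, forall x, x \in `[0, l] -> u x = F x}
    & exists2 g, Hs l k g & {ae mu, forall x, x \in `[0, l] -> dx l u x = g x}].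
Proof.
move=> l0 [_ [g [ug Hg]]].
have mu_ : measurable_fun `[0, l] u.
  by have [ui _ _] := ug; apply/measurable_EFinP; exact: measurable_int ui.
split => //.
  exact: weak_derivative_primitive (weak_derivative_dx ug).
exists g => //.
have [F Fg uF] := weak_derivative_primitive l0 ug.
exact: dx_ae_eq uF.
Qed.

End weak_derivative.

(** * Powers and inverses of positive functions on an edge *)

Section edge.
Variable R : realType.
Implicit Types (l x y : R) (f g u F G phi dphi : R -> R).

Lemma continuous_ae_ge l F k : 0 < l -> {within `[0, l], continuous F} ->
  {ae mu, forall x, x \in `[0, l] -> k <= F x} ->
  forall x, x \in `[0, l] -> k <= F x.
Proof.
move=> l0 cF kF x xl; apply/ler_addgt0Pr => e e0.
have [d d0 Hd] := within_continuous_uniform cF e0.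
have [y [yl yx Py]] := ae_near_itv xl l0 d0 kF.
have := Hd _ _ xl yl yx; rewrite ltr_norml => /andP[xy _].
by rewrite (le_trans Py)//; lra.
Qed.

(** The inverse is expressed through a real power of the square, whose base is nonnegative; at a
    zero of [u] both sides are 0. *)
Lemma measurable_fun_inv l u : measurable_fun `[0, l] u ->
  measurable_fun `[0, l] (fun x => (u x)^-1).
Proof.
move=> mu_; rewrite (_ : (fun x => _) = (fun x => u x * (u x ^+ 2) `^ (-1))).
  apply: measurable_funM => //.
  by apply: (measurableT_comp (measurable_powR _)); exact: measurable_funX.
apply/funext => x; rewrite powR_inv1 ?sqr_ge0//.
have [->|u0] := eqVneq (u x) 0; first by rewrite invr0 mul0r.
by field.
Qed.

Lemma primitive_integrable l F f : 0 <= l -> primitive l F f ->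
  mu.-integrable `[0, l] (EFin \o F).
Proof.
move=> l0 Ff; apply: continuous_compact_integrable; first exact: segment_compact.
exact: primitive_continuous Ff.
Qed.

(** The chain rule for functions smooth only on the positive half-line; derivability of [dphi]
    serves to give continuity of [dphi \o F]. *)
Lemma primitive_comp_gt0 l F f phi dphi : 0 <= l -> primitive l F f ->
  (forall x, x \in `[0, l] -> 0 < F x) ->
  (forall y, 0 < y -> is_derive y 1 phi (dphi y)) ->
  (forall y, 0 < y -> derivable dphi y 1) ->
  primitive l (phi \o F) (fun x => dphi (F x) * f x).
Proof.
move=> l0 Ff F0 dF ddF; apply: primitive_comp => //.
  by move=> x xl; apply/dF/F0.
apply: within_continuous_comp; last exact: primitive_continuous Ff.
move=> _ /set_mem[x xl <-].
by apply/differentiable_continuous/derivable1_diffP/ddF/F0.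
Qed.

Lemma primitive_powR l F f k : 0 <= l -> primitive l F f ->
  (forall x, x \in `[0, l] -> 0 < F x) ->
  primitive l (fun x => F x `^ k) (fun x => k * F x `^ (k - 1) * f x).
Proof.
move=> l0 Ff F0.
apply: (@primitive_comp_gt0 l F f (fun y => y `^ k) (fun y => k * y `^ (k - 1))) => //.
move=> y y0; apply: derivableM => //.
by apply: derivable_powR; rewrite in_itv/= y0.
Qed.

Lemma primitiveV l F f : 0 <= l -> primitive l F f ->
  (forall x, x \in `[0, l] -> 0 < F x) ->
  primitive l (fun x => (F x)^-1) (fun x => - (F x ^+ 2)^-1 * f x).
Proof.
move=> l0 Ff F0.
apply: (@primitive_comp_gt0 l F f (fun y => y^-1) (fun y => - (y ^+ 2)^-1)) => //.
- move=> y y0; have yn0 : id y != 0 by rewrite gt_eqF.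
  by have := is_deriveV yn0 (is_derive_id y 1); rewrite /GRing.scale/= mulr1.
- move=> y y0; have [d2 _] : is_derive y 1 (fun z : R => z ^+ 2) (2 * y).
    by apply: is_derive_eq; rewrite /= /GRing.scale/=; ring.
  by apply: derivableN; apply: derivableV => //; rewrite sqrf_eq0 gt_eqF.
Qed.

End edge.

(** * The weak momentum balance on a single edge *)

Section edge_identity.
Variable R : realType.

(** Every spatial quantity is replaced by its continuous representative; the left integrand becomes
    [- (h + k) * V] with [h] the derivative of [H], and integrating [h * V] by parts yields the
    endpoint terms. *)
Lemma edge_identity (l a b c gamma r : R) (rho m dtrho dtm v : R -> R) :
  0 < l -> 1 < gamma -> 0 < r ->
  Hs l 1 rho -> {ae mu, forall x, x \in `[0, l] -> r <= rho x} ->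
  Hs l 2 m -> Hs l 1 v ->
  {ae mu, forall x, x \in `[0, l] -> dtrho x + dx l m x = 0} ->
  {ae mu, forall x, x \in `[0, l] ->
    dtm x + dx l (fun y => m y ^+ 2 / rho y + c * rho y `^ gamma) x
    = a * rho x * dx l (fun y => (rho y ^+ 2)^-1 * dx l m y) x
      - b * (`|m x| * m x / rho x)} ->
  let P s := c / (gamma - 1) * s `^ gamma in
  let H x := trace l m x ^+ 2 / (2 * trace l rho x ^+ 2)
    + derive1 P (trace l rho x) - a / trace l rho x ^+ 2 * trace l (dx l m) x in
  \int[mu]_(x in `[0, l])
    (((rho x)^-1 * dtm x - m x / (2 * rho x ^+ 2) * dtrho x) * v x) =
  \int[mu]_(x in `[0, l]) ((m x ^+ 2 / (2 * rho x ^+ 2) + derive1 P (rho x)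
    - a / rho x ^+ 2 * dx l m x) * dx l v x)
  - \int[mu]_(x in `[0, l]) ((m x / (2 * rho x ^+ 2) * dx l m x
    + b * (`|m x| * m x / rho x ^+ 2)) * v x)
  - (H l * trace l v l - H 0 * trace l v 0).
Proof.
move=> l_gt0 gamma1 r0 Hrho rho_r Hm Hv mass momentum P Htr.
have l0 := ltW l_gt0.
have dP s : 0 < s -> derive1 P s = c / (gamma - 1) * (gamma * s `^ (gamma - 1)).
  move=> s0; rewrite derive1E; have dpow := is_derive1_powR gamma s0.
  by rewrite deriveZ//= derive_val.
have [mrho [RR pR rhoR] _] := Hs_primitive l_gt0 Hrho.
have [mm [M pM mM] [g Hg dmg]] := Hs_primitive l_gt0 Hm.
have [mg [N pN gN] _] := Hs_primitive l_gt0 Hg.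
have [mv [V pV vV] _] := Hs_primitive l_gt0 Hv.
have dmN : {ae mu, forall x, x \in `[0, l] -> dx l m x = N x}.
  by apply: filterS2 dmg gN => x dmg gN xl; rewrite dmg// gN.
have [dmi _] := pM; have [rhoi _] := pR.
have mdm : measurable_fun `[0, l] (dx l m).
  by apply/measurable_EFinP; exact: measurable_int dmi.
have cR := primitive_continuous l0 pR; have cM := primitive_continuous l0 pM.
have cN := primitive_continuous l0 pN; have cV := primitive_continuous l0 pV.
(* Positivity is needed at every point, not just a.e., to differentiate inverses and powers of
   [RR]. *)
have R0 x : x \in `[0, l] -> 0 < RR x.
  move=> xl; apply: (lt_le_trans r0).
  apply: (continuous_ae_ge l_gt0 cR _ xl).
  by apply: filterS2 rho_r rhoR => z + + zl => /(_ zl) rr /(_ zl) <-.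
set drho := dx l rho in pR rhoi; set dm := dx l m in pM dmi mdm dmN *.
set dg := dx l g in pN; set dv := dx l v in pV *.
(* The derivatives of the momentum flux and of the viscous quotient, written exactly as the product
   and chain rules produce them. *)
pose f1 x := (dm x * M x + M x * dm x) * (RR x)^-1
  + M x * M x * (- (RR x ^+ 2)^-1 * drho x)
  + c * (gamma * RR x `^ (gamma - 1) * drho x).
pose f2 x := (- (RR x ^+ 2)^-1 * drho x * (RR x)^-1
  + (RR x)^-1 * (- (RR x ^+ 2)^-1 * drho x)) * N x
  + (RR x)^-1 * (RR x)^-1 * dg x.
have pA := primitiveV l0 pR R0.
have pMA := primitiveM l0 pM pA.
have p1 : primitive l (fun x => M x * M x * (RR x)^-1 + c * RR x `^ gamma) f1.
  exact: primitiveD (primitiveM l0 (primitiveM l0 pM pM) pA)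
    (primitiveZ c (primitive_powR gamma l0 pR R0)).
have p2 : primitive l (fun x => (RR x)^-1 * (RR x)^-1 * N x) f2.
  exact: primitiveM l0 (primitiveM l0 pA pA) pN.
pose K := c / (gamma - 1) * gamma.
pose H x := 2^-1 * ((M x * (RR x)^-1) * (M x * (RR x)^-1))
  + K * RR x `^ (gamma - 1) + - a * ((RR x)^-1 * (RR x)^-1 * N x).
pose w x := dm x * (RR x)^-1 + M x * (- (RR x ^+ 2)^-1 * drho x).
pose h x := 2^-1 * (w x * (M x * (RR x)^-1) + (M x * (RR x)^-1) * w x)
  + K * ((gamma - 1) * RR x `^ (gamma - 1 - 1) * drho x) + - a * f2 x.
have pH : primitive l H h.
  exact: primitiveD (primitiveD (primitiveZ 2^-1 (primitiveM l0 pMA pMA))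
    (primitiveZ K (primitive_powR (gamma - 1) l0 pR R0))) (primitiveZ (- a) p2).
have g10 : gamma - 1 != 0 by rewrite subr_eq0 gt_eqF.
(* Dividing the flux derivative by the density gives the derivative of the kinetic and potential
   part of [H] plus [M x * dm x / RR x ^+ 2]. Splitting one factor [RR x] off the power lets [field]
   close the identity. *)
have hE x : x \in `[0, l] ->
    h x = f1 x / RR x - M x * dm x / RR x ^+ 2 - a * f2 x.
  move=> xl; have Rx := R0 x xl; have Rx0 : RR x != 0 by rewrite gt_eqF.
  rewrite /h /f1 /w /K -(mulr_powRB1 (ltW Rx) (_ : 0 < gamma - 1)) ?subr_gt0//.
  by field; rewrite Rx0.
have d1 : {ae mu, forall x, x \in `[0, l] ->
    dx l (fun y => m y ^+ 2 / rho y + c * rho y `^ gamma) x = f1 x}.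
  apply: (dx_ae_eq l_gt0 p1).
    apply: measurable_funD.
      by apply: measurable_funM; [exact: measurable_funX|exact: measurable_fun_inv].
    apply: measurable_funM; first exact: measurable_cst.
    exact: (measurableT_comp (measurable_powR _)).
  by apply: filterS2 mM rhoR => x + + xl => /(_ xl) -> /(_ xl) ->; rewrite expr2.
have d2 : {ae mu, forall x, x \in `[0, l] ->
    dx l (fun y => (rho y ^+ 2)^-1 * dm y) x = f2 x}.
  apply: (dx_ae_eq l_gt0 p2).
    apply: measurable_funM => //.
    by apply: measurable_fun_inv; exact: measurable_funX.
  apply: filterS2 dmN rhoR => x + + xl => /(_ xl) -> /(_ xl) ->.
  by rewrite expr2 invfM.
(* Half of [M x * dm x / RR x ^+ 2] remains, since the mass equation turns the [dtrho] term into the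
   other half with opposite sign. *)
pose k x := M x / (2 * RR x ^+ 2) * dm x + b * (`|M x| * M x / RR x ^+ 2).
have ki : mu.-integrable `[0, l] (EFin \o k).
  have pMAA := primitiveM l0 pMA pA.
  have i1 := integrable_mul_continuous (primitive_continuous l0 (primitiveZ 2^-1 pMAA)) dmi.
  have cnM : {within `[0, l], continuous (fun x => `|M x|)}.
    by apply: (@within_continuous_comp _ _ _ _ M Num.norm) cM => y _; exact: norm_continuous.
  have i2 := integrable_mul_continuous cnM (primitive_integrable l0 (primitiveZ b pMAA)).
  rewrite (_ : k = fun x => 2^-1 * (M x * (RR x)^-1 * (RR x)^-1) * dm x +
      `|M x| * (b * (M x * (RR x)^-1 * (RR x)^-1))).
    exact: (integrableD _ i1 i2).
  by apply/funext => x; rewrite /k expr2 !invfM; ring.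
have hVi := integrable_continuous_mul cV (proj1 pH).
have kVi := integrable_continuous_mul cV ki.
have -> : \int[mu]_(x in `[0, l])
    (((rho x)^-1 * dtm x - m x / (2 * rho x ^+ 2) * dtrho x) * v x) =
    \int[mu]_(x in `[0, l]) (- (h x * V x + k x * V x)).
  apply: Rintegral_ae_eq.
  apply: filterS2 (filterI mass momentum) (filterI (filterI rhoR mM) (filterI vV (filterI d1 d2))).
  move=> x [mass_x mom_x] [[rhoR_x mM_x] [vV_x [d1_x d2_x]]] xl.
  have Rx0 : RR x != 0 by rewrite gt_eqF// R0.
  move: (mass_x xl) (mom_x xl); rewrite d1_x// d2_x// rhoR_x// mM_x// vV_x// hE// /k -/dm.
  move=> /eqP; rewrite addr_eq0 => /eqP -> /(canRL (addrK _)) ->.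
  by field.
rewrite RintegralN RintegralD// opprD.
have ibp := integration_by_parts_primitive l0 pH pV.
have -> : \int[mu]_(x in `[0, l]) (h x * V x) =
    H l * V l - H 0 * V 0 - \int[mu]_(x in `[0, l]) (H x * dv x).
  by rewrite ibp; ring.
have -> : \int[mu]_(x in `[0, l]) ((m x ^+ 2 / (2 * rho x ^+ 2) + derive1 P (rho x)
    - a / rho x ^+ 2 * dm x) * dv x) = \int[mu]_(x in `[0, l]) (H x * dv x).
  apply: Rintegral_ae_eq.
  apply: filterS2 (filterI rhoR mM) dmN => x [rhoR_x mM_x] dmN_x xl.
  have Rx0 : RR x != 0 by rewrite gt_eqF// R0.
  rewrite rhoR_x// mM_x// dmN_x// dP ?R0// /H /K; congr (_ * _).
  by field; rewrite Rx0.
have -> : \int[mu]_(x in `[0, l]) ((m x / (2 * rho x ^+ 2) * dm x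
    + b * (`|m x| * m x / rho x ^+ 2)) * v x) = \int[mu]_(x in `[0, l]) (k x * V x).
  apply: Rintegral_ae_eq.
  apply: filterS2 (filterI rhoR mM) vV => x [rhoR_x mM_x] vV_x xl.
  by rewrite rhoR_x// mM_x// vV_x.
have HE x : x \in `[0, l] -> Htr x = H x.
  move=> xl; have Rx0 : RR x != 0 by rewrite gt_eqF// R0.
  rewrite /Htr (trace_ae_eq l_gt0 cM mM)// (trace_ae_eq l_gt0 cR rhoR)//.
  rewrite (trace_ae_eq l_gt0 cN dmN)// dP ?R0// /H /K.
  by field; rewrite Rx0.
have l_in : l \in `[0, l] by rewrite in_itv/= l0 lexx.
have o_in : 0 \in `[0, l] by rewrite in_itv/= l0 lexx.
have Vl := trace_ae_eq l_gt0 cV vV l_in; have V0 := trace_ae_eq l_gt0 cV vV o_in.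
rewrite (HE l l_in) (HE 0 o_in) Vl V0; ring.
Qed.

End edge_identity.

(** * Regrouping of endpoint terms by vertices *)

Section junction.
Variables (R : realType) (G : network R).
Implicit Types (e : edge G) (x : vertex G).

(** Double counting: an edge is incident on exactly its two endpoints, distinct by [edges_irrefl],
    with normal 1 at [e.2] and -1 at [e.1]. *)
Lemma sum_incident_normal (F : edge G -> vertex G -> R) :
  \sum_x \sum_(e in incident x) F e x * normal e x =
  \sum_(e in edges G) (F e e.2 - F e e.1).
Proof.
rewrite (exchange_big_dep (mem (edges G))) /=; last first.
  by move=> x e _; rewrite inE => /andP[].
apply: eq_bigr => e eG; have e12 := edges_irrefl eG.
rewrite (bigD1 e.1) /=; last by rewrite inE eG eqxx.
rewrite (bigD1 e.2) /=; last by rewrite inE eG eqxx orbT eq_sym.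
rewrite big1 ?addr0 => [|x /andP[/andP[]]]; last first.
  by rewrite inE eG /= eq_sym [e.2 == x]eq_sym => /orP[->|->]//=; rewrite ?andbF.
by rewrite /normal eqxx [e.2 == e.1]eq_sym (negbTE e12) eqxx mulrN1 mulr1 addrC.
Qed.

Lemma sum_incident_eq0 x (h w : edge G -> R) :
  (exists k, forall e, e \in incident x -> h e = k) ->
  \sum_(e in incident x) w e * normal e x = 0 ->
  \sum_(e in incident x) h e * w e * normal e x = 0.
Proof.
move=> [k hk] w0; rewrite (eq_bigr (fun e => k * (w e * normal e x))).
  by rewrite -mulr_sumr w0 mulr0.
by move=> e ex; rewrite hk// mulrA.
Qed.

End junction.

(** * Summation over the network and cancellation at the vertices *)

Theorem lemma3p1 (R : realType) (G : network R) (a b c : edge G -> R)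
    (gamma T : R) (rho m dtrho dtm : R -> netfun G) :
  (forall e, e \in edges G -> [/\ 0 <= a e, 0 <= b e & 0 < c e]) ->
  1 < gamma ->
  smooth_solution a b c gamma T rho m dtrho dtm ->
  forall t, 0 < t <= T ->
  forall q v : netfun G, LpE 2%:E q -> H0div v ->
  ip (dtrho t) q = - ip (Dx (m t)) q /\
  ip (fun e x => (rho t e x)^-1 * dtm t e x
                 - m t e x / (2 * rho t e x ^+ 2) * dtrho t e x) v
  = ip (fun e x => m t e x ^+ 2 / (2 * rho t e x ^+ 2)
                   + derive1 (potential c gamma e) (rho t e x)
                   - a e / rho t e x ^+ 2 * Dx (m t) e x) (Dx v)
    - ip (fun e x => m t e x / (2 * rho t e x ^+ 2) * Dx (m t) e x
                     + b e * (`|m t e x| * m t e x / rho t e x ^+ 2)) v.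
Proof.
move=> _ gamma1 sol t /andP[t0 tT] q v _ [Hv v_div].
have tin : t \in `[0, T] by rewrite in_itv/= ltW.
have [Hrho [r r0 rho_r]] := (rho_C0 sol).1 t tin.
have Hm := (m_C0 sol).1 t tin.
have t0T : 0 < t <= T by rewrite t0.
have eqs := sol_eqs sol t0T.
split.
  rewrite /ip -sumrN; apply: eq_bigr => e eG.
  rewrite -RintegralN; apply: Rintegral_ae_eq.
  apply: filterS (flow_mass eqs eG) => x + xl => /(_ xl)/eqP; rewrite addr_eq0 => /eqP ->.
  by rewrite mulNr.
pose H e x := at_vertex (m t) e x ^+ 2 / (2 * at_vertex (rho t) e x ^+ 2)
  + derive1 (potential c gamma e) (at_vertex (rho t) e x)
  - a e / at_vertex (rho t) e x ^+ 2 * at_vertex (Dx (m t)) e x.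
have bnd0 : \sum_(e in edges G) (H e e.2 * at_vertex v e e.2
    - H e e.1 * at_vertex v e e.1) = 0.
  rewrite -(sum_incident_normal (fun e x => H e x * at_vertex v e x)).
  apply: big1 => x _; apply: sum_incident_eq0; last exact: v_div.
  have [/(flow_inner_enthalpy eqs)[k hk]|] := boolP (inner x).
    by exists k => e ex; rewrite /H hk// addrK.
  (* A boundary vertex has at most one incident edge, so [H] takes at most one value there; with no
     edge any constant will do. *)
  rewrite /inner -leqNgt => /card_le1_eqP x1.
  have [e0 e0x|no] := pickP (mem (incident x)); last first.
    by exists 0 => e ex; have := no e; rewrite /= ex.
  by exists (H e0 x) => e ex; rewrite (x1 _ _ ex e0x).
(* The vanishing sum [bnd0] is subtracted on the right, so that the claim splits into one
   [edge_identity] per edge. *)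
rewrite /ip -[RHS]subr0 -[X in _ = _ - X]bnd0 -!sumrB; apply: eq_bigr => e eG.
have := edge_identity (len_gt0 eG) gamma1 r0 (Hrho e eG) (rho_r e eG) (Hm e eG)
  (Hv e eG) (flow_mass eqs eG) (flow_momentum eqs eG).
rewrite /= => ->.
have e12 := edges_irrefl eG.
by rewrite /H /at_vertex /endpoint eqxx [e.2 == e.1]eq_sym (negbTE e12).
Qed.
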